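(* The class $\mathbf{CRL}$ of completely representable bounded distributive lattices is not closed under ultraroots; that is, there are a bounded lattice $L$, a set $I$ and an ultrafilter $U$ over $I$ such that the ultrapower $\prod_U L$ belongs to $\mathbf{CRL}$ but $L\notin\mathbf{CRL}$.
   Context: A representation of a bounded distributive lattice $L$ is a lattice embedding $h\colon L\to\wp(X)$ for some set $X$, where $\wp(X)$ is regarded as a ring of sets under union and intersection; representations are assumed irredundant, i.e. for every $x\in X$ there is $a\in L$ with $x\in h(a)$. A representation $h$ is complete if for all $S\subseteq L$: whenever $\bigwedge S$ exists in $L$, $h(\bigwedge S)=\bigcap h[S]$, and whenever $\bigvee S$ exists in $L$, $h(\bigvee S)=\bigcup h[S]$. $\mathbf{CRL}$ is the class of bounded distributive lattices that have a complete representation. A class of structures is closed under ultraroots if it contains a structure whenever it contains some ultrapower of that structure. *)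

(* Defs.v *)
From HB Require Import structures.
From mathcomp Require Import all_boot all_order.
From mathcomp Require Import boolp classical_sets filter.

Set Implicit Arguments.
Unset Strict Implicit.
Unset Printing Implicit Defensive.

Import Order.TTheory.
Local Open Scope classical_set_scope.
Local Open Scope quotient_scope.

Section Ultrapower.
Context (d : Order.disp_t) (L : tbLatticeType d) (I : Type) (U : set_system I)
  (FU : UltraFilter U).

Definition ultra_eq : rel (I -> L) :=
  fun f g => `[< U [set i | f i = g i] >].

Lemma ultra_eq_refl : reflexive ultra_eq.
Proof. by move=> f; apply/asboolP; exact: filterE. Qed.

Lemma ultra_eq_sym : symmetric ultra_eq.
Proof.
by move=> f g; apply/asboolP/asboolP; apply: filterS => i /= ->.
Qed.

Lemma ultra_eq_trans : transitive ultra_eq.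
Proof.
move=> g f h /asboolP fg /asboolP gh; apply/asboolP.
by move: fg gh; apply: filterS2 => i /= -> ->.
Qed.

Canonical ultra_equiv :=
  EquivRel ultra_eq ultra_eq_refl ultra_eq_sym ultra_eq_trans.

Definition ultrapower : Type := {eq_quot ultra_equiv}.

HB.instance Definition _ := Choice.on ultrapower.
HB.instance Definition _ := EqQuotient.on ultrapower.

Implicit Types (f g : I -> L) (x y z : ultrapower).

Lemma ultra_piP f g :
  (\pi_ultrapower f = \pi_ultrapower g) <-> U [set i | f i = g i].
Proof.
split; first by move/eqP; rewrite eqmodE => /asboolP.
by move=> fg; apply/eqP; rewrite eqmodE; apply/asboolP.
Qed.

Lemma ultra_repr f : U [set i | repr (\pi_ultrapower f) i = f i].
Proof. by apply/ultra_piP; rewrite reprK. Qed.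

Definition ultra_le : rel ultrapower :=
  fun x y => `[< U [set i | (repr x i <= repr y i)%O] >].

Definition ultra_meet x y : ultrapower :=
  \pi_ultrapower (fun i => (repr x i `&` repr y i)%O).

Definition ultra_join x y : ultrapower :=
  \pi_ultrapower (fun i => (repr x i `|` repr y i)%O).

Definition ultra_bot : ultrapower := \pi_ultrapower (fun=> \bot%O).

Definition ultra_top : ultrapower := \pi_ultrapower (fun=> \top%O).

(* The operations do not depend on the chosen representatives. *)
Lemma ultra_leE f g :
  ultra_le (\pi_ultrapower f) (\pi_ultrapower g) <-> U [set i | (f i <= g i)%O].
Proof.
have Uf := ultra_repr f; have Ug := ultra_repr g.
split=> [/asboolP fg|fg]; last apply/asboolP.
  by move: Uf Ug fg; apply: filterS3 => i /= -> ->.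
by move: Uf Ug fg; apply: filterS3 => i /= -> ->.
Qed.

Lemma ultra_meetE f g :
  ultra_meet (\pi_ultrapower f) (\pi_ultrapower g) =
    \pi_ultrapower (fun i => (f i `&` g i)%O).
Proof.
apply/ultra_piP; move: (ultra_repr f) (ultra_repr g).
by apply: filterS2 => i /= -> ->.
Qed.

Lemma ultra_joinE f g :
  ultra_join (\pi_ultrapower f) (\pi_ultrapower g) =
    \pi_ultrapower (fun i => (f i `|` g i)%O).
Proof.
apply/ultra_piP; move: (ultra_repr f) (ultra_repr g).
by apply: filterS2 => i /= -> ->.
Qed.

Lemma ultra_le_refl : reflexive ultra_le.
Proof. by move=> x; apply/asboolP; apply: filterE => i /=; exact: lexx. Qed.

Lemma ultra_le_anti : antisymmetric ultra_le.
Proof.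
move=> x y /andP[/asboolP xy /asboolP yx].
rewrite -[x]reprK -[y]reprK; apply/ultra_piP.
by move: xy yx; apply: filterS2 => i /= xy yx; apply/le_anti/andP.
Qed.

Lemma ultra_le_trans : transitive ultra_le.
Proof.
move=> y x z /asboolP xy /asboolP yz; apply/asboolP.
by move: xy yz; apply: filterS2 => i /=; exact: le_trans.
Qed.

HB.instance Definition _ := Order.Le_isPOrder.Build d ultrapower
  ultra_le_refl ultra_le_anti ultra_le_trans.

Lemma ultra_meetP x y z :
  (x <= ultra_meet y z)%O = (x <= y)%O && (x <= z)%O.
Proof.
apply/idP/andP => [|[]].
- rewrite -{1}[x]reprK => /ultra_leE xyz.
  by split; apply/asboolP; move: xyz; apply: filterS => i /=;
    rewrite lexI => /andP[].
- move=> /asboolP xy /asboolP xz; rewrite -[x]reprK; apply/ultra_leE.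
  by move: xy xz; apply: filterS2 => i /= xy xz; rewrite lexI xy.
Qed.

Lemma ultra_joinP x y z :
  (ultra_join x y <= z)%O = (x <= z)%O && (y <= z)%O.
Proof.
apply/idP/andP => [|[]].
- rewrite -{1}[z]reprK => /ultra_leE xyz.
  by split; apply/asboolP; move: xyz; apply: filterS => i /=;
    rewrite leUx => /andP[].
- move=> /asboolP xz /asboolP yz; rewrite -[z]reprK; apply/ultra_leE.
  by move: xz yz; apply: filterS2 => i /= xz yz; rewrite leUx xz.
Qed.

HB.instance Definition _ := Order.POrder_MeetJoin_isLattice.Build d ultrapower
  ultra_meetP ultra_joinP.

Lemma ultra_le0x x : (ultra_bot <= x)%O.
Proof.
by rewrite -[x]reprK; apply/ultra_leE; apply: filterE => i; exact: le0x.
Qed.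

Lemma ultra_lex1 x : (x <= ultra_top)%O.
Proof.
by rewrite -[x]reprK; apply/ultra_leE; apply: filterE => i; exact: lex1.
Qed.

HB.instance Definition _ := Order.hasBottom.Build d ultrapower ultra_le0x.
HB.instance Definition _ := Order.hasTop.Build d ultrapower ultra_lex1.

End Ultrapower.
Arguments ultrapower {d} L {I U} FU.

Section Representations.
Context (d : Order.disp_t) (L : tbLatticeType d) (X : Type).

Record representation (h : L -> set X) : Prop := Representation {
  repr_inj : injective h ;
  repr_meet : forall a b, h (a `&` b)%O = h a `&` h b ;
  repr_join : forall a b, h (a `|` b)%O = h a `|` h b ;
  repr_irredundant : forall x, exists a, h a x
}.

(* [S] may be empty; [\bigcap] over the empty set is then all of [X], and
   [\bigcup] is [set0], so that [h] preserves the bounds. *)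
Definition complete (h : L -> set X) : Prop := forall (S : set L) (m : L),
  (infimums S m -> h m = \bigcap_(a in S) h a) /\
  (supremums S m -> h m = \bigcup_(a in S) h a).

End Representations.

(* For a representable [L] distributivity is automatic; it is stated because
   the lattice structure on [ultrapower] is not registered as distributive. *)
Definition CRL (d : Order.disp_t) (L : tbLatticeType d) : Prop :=
  left_distributive (@Order.meet d L) (@Order.join d L) /\
  exists (X : Type) (h : L -> set X), representation h /\ complete h.

Definition closed_under_ultraroots
    (K : forall d : Order.disp_t, tbLatticeType d -> Prop) : Prop :=
  forall (d : Order.disp_t) (L : tbLatticeType d) (I : Type)
    (U : set_system I) (FU : UltraFilter U),
  K d (ultrapower L FU) -> K d L.

(* Main.v *)
Require Import Defs.
From mathcomp Require Import all_boot all_order.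
From mathcomp Require Import boolp classical_sets filter.
From mathcomp Require Import ssralg ssrnum reals constructive_ereal ereal.
From mathcomp Require Import Rstruct.

(** In a dense chain, a point of a complete representation determines a gap: a
    cut whose lower part has no supremum and whose upper part has no infimum.
    A complete dense chain, such as the extended real line, has no gaps.  In its
    ultrapower over a nonprincipal ultrafilter on [nat], diagonalization shows
    that no strictly increasing sequence has a supremum; the upper bounds of
    such a sequence then form the upper part of a gap, and by density these gaps
    separate points. *)

Set Implicit Arguments.
Unset Strict Implicit.
Unset Printing Implicit Defensive.

Import Order.TTheory Num.Theory.
Local Open Scope classical_set_scope.
Local Open Scope order_scope.

Definition dense (d : Order.disp_t) (T : porderType d) : Prop :=
  forall x y : T, x < y -> exists z, x < z < y.

Section TotalPOrder.
Context (d : Order.disp_t) (T : porderType d).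
Hypothesis T_total : total (<=%O : rel T).

Lemma total_nle_lt (x y : T) : ~ x <= y -> y < x.
Proof.
move=> /negP nxy; have yx : y <= x by case/orP: (T_total x y) nxy => [->|].
by rewrite lt_neqAle yx andbT; apply: contraNneq nxy => ->.
Qed.

(** Density lets one choose, for each [x] below [b], a point [g x] strictly between [x] and [b]; the
    sequence iterates [g]. *)
Lemma dense_increasing_seq (a b : T) : dense T -> a < b ->
  exists c : nat -> T, (forall k, c k < c k.+1) /\ (forall k, a < c k < b).
Proof.
move=> denseT ab.
have [g gP] : {g : T -> T & forall x, x < b -> x < g x < b}.
  apply: (@choice T T (fun x y => x < b -> x < y < b)) => x.
  have [xb|nxb] := boolP (x < b); last by exists x.
  by have [z zP] := denseT _ _ xb; exists z.
(* Starting at [g a] instead of [a] puts the zeroth term strictly above [a]. *)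
have cP k : a < iter k g (g a) < b.
  elim: k => [|k /andP[ac cb]]; first exact: gP.
  by have /andP[cc' c'b] := gP _ cb; rewrite (lt_trans ac cc').
exists (fun k => iter k g (g a)); split=> // k.
by have /andP[_ /gP/andP[]] := cP k.
Qed.

End TotalPOrder.

Section TotalLattice.
Context (d : Order.disp_t) (M : tbLatticeType d).
Hypothesis M_total : total (<=%O : rel M).

Lemma total_meet (x y : M) : x `&` y = x \/ x `&` y = y.
Proof.
by case/orP: (M_total x y) => [/meet_idPl|/meet_idPr] ->; [left|right].
Qed.

Lemma total_join (x y : M) : x `|` y = x \/ x `|` y = y.
Proof.
by case/orP: (M_total x y) => [/join_idPr|/join_idPl] ->; [right|left].
Qed.

Lemma total_left_distributive :
  left_distributive (@Order.meet d M) (@Order.join d M).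
Proof.
move=> x y z; apply/le_anti/andP; split; last first.
  by rewrite leUx !leI2 ?leUl ?leUr.
by case: (total_join x y) => ->; rewrite ?leUl ?leUr.
Qed.

(** The points are the strictly increasing sequences, and [c] belongs to [h a] when [a] bounds it.
    Infima are preserved because an infimum of upper bounds of [c] still bounds [c]; suprema are
    preserved because [c] has no least upper bound. *)
Lemma increasing_nosup_CRL : dense M ->
  (forall (c : nat -> M) m, (forall k, c k < c k.+1) ->
     ~ supremums (range c) m) ->
  CRL M.
Proof.
move=> denseM nosup; split; first exact: total_left_distributive.
pose X := {c : nat -> M | forall k, c k < c k.+1}.
pose h (a : M) : set X := [set c | forall k, sval c k <= a].
have h_le a b : a <= b -> h a `<=` h b.
  by move=> ab c ca k; exact: le_trans (ca k) ab.
(* A sequence running strictly between [a] and [b] lies in [h b] but not in [h a]. *)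
have h_sep a b : a < b -> h a <> h b.
  move=> ab hab; have [c [cinc cab]] := dense_increasing_seq denseM ab.
  have hb : h b (exist _ c cinc) by move=> k; case/andP: (cab k) => _ /ltW.
  rewrite -hab in hb; have /andP[+ _] := cab 0%N.
  by rewrite le_gtF //; exact: (hb 0%N).
exists X, h; split; [split|].
- move=> a b hab; have [//|/eqP ab] := eqVneq a b; exfalso.
  case/orP: (M_total a b) => le_ab; last move/esym in hab.
    by apply: (@h_sep a b) => //; rewrite lt_neqAle le_ab andbT; apply/eqP.
  apply: (@h_sep b a) => //; rewrite lt_neqAle le_ab andbT.
  by apply/eqP/nesym.
- move=> a b; apply/seteqP; split=> c /=.
    by move=> cab; split; move: cab; apply: h_le; rewrite ?leIl ?leIr.
  by move=> [ca cb]; case: (total_meet a b) => ->.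
- move=> a b; apply/seteqP; split=> c /=.
    by case: (total_join a b) => ->; [left|right].
  by case; apply: h_le; rewrite ?leUl ?leUr.
- by move=> c; exists \top => k; exact: lex1.
move=> S m; split=> [[m_lb m_glb]|[m_ub m_lub]]; apply/seteqP; split=> c /=.
- by move=> cm a Sa; apply: h_le cm; exact: m_lb.
- by move=> cS k; apply: m_glb => a Sa; exact: cS.
(* If no member of [S] bounds [c], each lies below some term of [c]. Every upper bound of [c] then
   bounds [S], so [m] would be the supremum of [c]. *)
- move=> cm; apply: contrapT => ncS; apply: (nosup (sval c) m (svalP c)).
  split=> [_ [k _ <-]|t t_ub]; first exact: cm.
  apply: m_lub => a Sa; have [k nca] : exists k, ~ sval c k <= a.
    by apply/existsNP => ca; apply: ncS; exists a.
  apply: le_trans (ltW (total_nle_lt M_total nca)) _.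
  by apply: t_ub; exists k.
- by move=> [a Sa]; apply: h_le; exact: m_ub.
Qed.

(** For a point [x], let [m] be the supremum of the elements whose image misses [x]. Completeness
    keeps [x] out of [h m]. By density [m] is also the infimum of the elements whose image contains
    [x], which forces [x] into [h m]. *)
Lemma complete_dense_not_CRL : dense M -> (\bot : M) < \top ->
  (forall S : set M, exists m, supremums S m) -> ~ CRL M.
Proof.
move=> denseM bt allsup [_ [X [h [[h_inj h_meet _ _] h_complete]]]].
have h_le a b : a <= b -> h a `<=` h b.
  by move=> /meet_idPl abE; rewrite -{1}abE h_meet => x [].
(* Over an empty [X], [h] would identify [\bot] and [\top]. *)
have [x _] : exists x : X, True.
  apply: contrapT => nX; move: bt; rewrite (h_inj \bot \top) ?ltxx //.
  by apply/seteqP; split=> x _; exfalso; apply: nX; exists x.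
have [m m_sup] := allsup [set a | ~ h a x].
have nhm : ~ h m x.
  by rewrite ((h_complete _ _).2 m_sup) => -[a].
apply: (nhm); rewrite ((h_complete [set a | h a x] m).1 _) //.
have [m_ub _] := m_sup; split=> [a /= ha|l l_lb].
  case/orP: (M_total m a) => // am.
  by exfalso; apply: nhm; exact: h_le am x ha.
(* A [c] strictly between [m] and [l] has no place: if [x] is in [h c] then [l <= c], and otherwise
   [c <= m]. *)
apply: contrapT => /(total_nle_lt M_total)/denseM[c /andP[mc cl]].
have [hc|nhc] := pselect (h c x).
  by move: cl; rewrite le_gtF // l_lb.
by move: mc; rewrite le_gtF // m_ub.
Qed.

End TotalLattice.

Section UltrapowerChain.
Context (d : Order.disp_t) (L : tbLatticeType d) (I : Type) (U : set_system I).
Context (FU : UltraFilter U).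
Hypothesis L_total : total (<=%O : rel L).
Implicit Types x y : ultrapower L FU.

Lemma ultra_leP x y : x <= y <-> U [set i | repr x i <= repr y i].
Proof. by split=> [/asboolP|?]; last apply/asboolP. Qed.

(** Maximality of [U] enters here: a set or its complement is [U]-large. Totality and the strict
    order are thereby read off coordinatewise. *)
Lemma ultra_nle_lt x y : ~ x <= y -> U [set i | repr y i < repr x i].
Proof.
move=> nxy; have [Uxy|] := in_ultra_setVsetC [set i | repr x i <= repr y i] FU.
  by case: nxy; apply/ultra_leP.
by apply: filterS => i /= /(total_nle_lt L_total).
Qed.

Lemma ultra_total : total (<=%O : rel (ultrapower L FU)).
Proof.
move=> x y; have [//|/negP/ultra_nle_lt yx /=] := boolP (x <= y).
by apply/ultra_leP; move: yx; apply: filterS => i /ltW.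
Qed.

Lemma ultra_ltP x y : x < y <-> U [set i | repr x i < repr y i].
Proof.
split=> [xy|Uxy]; first by apply: ultra_nle_lt; rewrite lt_geF.
apply: (total_nle_lt ultra_total) => /ultra_leP Uyx.
have : U set0.
  move: Uxy Uyx; apply: filterS2 => i /= xy.
  by rewrite lt_geF.
exact: filter_not_empty.
Qed.

Lemma ultra_dense : dense L -> dense (ultrapower L FU).
Proof.
move=> denseL x y /ultra_ltP Uxy.
have [f fP] : {f : I -> L &
    forall i, repr x i < repr y i -> repr x i < f i < repr y i}.
  apply: (@choice I L (fun i z => repr x i < repr y i ->
    repr x i < z < repr y i)) => i.
  have [xy|nxy] := boolP (repr x i < repr y i).
    by have [z zP] := denseL _ _ xy; exists z.
  (* A default value, used only outside the [U]-large set where [x] is below [y]. *)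
  by exists \bot.
have Uf := ultra_repr FU f; exists (\pi_(ultrapower L FU) f)%qT.
apply/andP; split; apply/ultra_ltP; move: Uxy Uf;
  by apply: filterS2 => i /= /fP/andP[xf fy] ->.
Qed.

End UltrapowerChain.

(** The witness is the largest of the finitely many values below [s]; [f 0] ensures that there is
    one. *)
Lemma total_finite_bound_lt (d : Order.disp_t) (L : tbLatticeType d)
    (f : nat -> L) (s : L) (n : nat) : total (<=%O : rel L) -> f 0%N < s ->
  exists2 t, t < s & forall k, (k <= n)%N -> f k < s -> f k <= t.
Proof.
move=> L_total f0s; elim: n => [|n [t ts tP]].
  by exists (f 0%N) => // k; rewrite leqn0 => /eqP ->.
have [fs|nfs] := boolP (f n.+1 < s); last first.
  exists t => // k; rewrite leq_eqVlt => /predU1P[->|]; last exact: tP.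
  by rewrite (negbTE nfs).
exists (t `|` f n.+1).
  by case: (total_join L_total t (f n.+1)) => ->.
move=> k; rewrite leq_eqVlt => /predU1P[-> _|kn fks]; first exact: leUr.
by apply: le_trans (leUl _ _); exact: tP.
Qed.

(** An upper bound [m] is never least: a class strictly below it still bounds the whole sequence. *)
Lemma ultra_increasing_nosup (d : Order.disp_t) (L : tbLatticeType d)
    (U : set_system nat) (FU : UltraFilter U) (c : nat -> ultrapower L FU)
    (m : ultrapower L FU) : total (<=%O : rel L) -> \oo `<=` U ->
  (forall k, c k < c k.+1) -> ~ supremums (range c) m.
Proof.
move=> L_total ooU cinc [m_ub m_lub].
have c_lt k : c k < m.
  by apply: lt_le_trans (cinc k) _; apply: m_ub; exists k.+1.
have {c_lt} Uc k : U [set i | repr (c k) i < repr m i].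
  exact/(ultra_ltP L_total).
(* The diagonal: [t i] need only bound the first [i] terms that lie below [m]. *)
have [t tP] : {t : nat -> L & forall i, repr (c 0%N) i < repr m i ->
    t i < repr m i /\
    forall k, (k <= i)%N -> repr (c k) i < repr m i -> repr (c k) i <= t i}.
  apply: (@choice nat L (fun i z => repr (c 0%N) i < repr m i ->
    z < repr m i /\ forall k, (k <= i)%N -> repr (c k) i < repr m i ->
      repr (c k) i <= z)) => i.
  have [c0m|nc0m] := boolP (repr (c 0%N) i < repr m i); last by exists \bot.
  have [t tm tP] :=
    @total_finite_bound_lt _ _ (fun k => repr (c k) i) _ i L_total c0m.
  by exists t.
have Ut := ultra_repr FU t.
have : m <= (\pi_(ultrapower L FU) t)%qT.
  apply: m_lub => _ [k _ <-]; apply/ultra_leP.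
  (* The [k]-th term may escape [t] only at coordinates before [k] or where it is not below [m];
     both sets are [U]-negligible. *)
  have Uk : U [set i | (k <= i)%N] by apply: ooU; exists k.
  have Utk :
      U [set i | repr (\pi_(ultrapower L FU) t)%qT i = t i /\ (k <= i)%N].
    exact: filterI.
  move: (Uc 0%N) (Uc k) Utk.
  apply: filterS3 => i /= /tP[_ tP'] ckm [-> ki].
  exact: tP'.
(* [t] is below [m] wherever the zeroth term is, hence on a [U]-large set. *)
apply/negP; rewrite lt_geF //; apply/(ultra_ltP L_total).
by move: (Uc 0%N) Ut; apply: filterS2 => i /= /tP[+ _] ->.
Qed.

Lemma ereal_dense (R : realFieldType) : dense (\bar R).
Proof.
move=> [r||] [s||] //=.
- rewrite lte_fin => rs; exists ((r + s) / 2)%R%:E.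
  by rewrite !lte_fin midf_lt ?midf_lt.
- by move=> _; exists (r + 1)%R%:E; rewrite lte_fin ltrDl ltr01 ltry.
- by move=> _; exists (s - 1)%R%:E; rewrite lte_fin gtrBl ltr01 ltNyr.
- by move=> _; exists 0%R%:E; rewrite ltNyr ltry.
Qed.

Theorem mainTheorem5 :
  ~ closed_under_ultraroots (@CRL) /\
  exists (d : Order.disp_t) (L : tbLatticeType d) (I : Type)
    (U : set_system I) (FU : UltraFilter U),
    CRL (ultrapower L FU) /\ ~ CRL L.
Proof.
pose L : tbLatticeType _ := \bar Rdefinitions.R.
(* Extending the filter [\oo] of eventual properties makes [U] nonprincipal. *)
have [U [FU ooU]] := @ultraFilterLemma nat \oo _.
have L_total : total (<=%O : rel L) by exact: le_total.
have CRL_power : CRL (ultrapower L FU).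
  apply: increasing_nosup_CRL; first exact: ultra_total.
    by apply: ultra_dense => //; exact: ereal_dense.
  by move=> c m; exact: ultra_increasing_nosup.
have nCRL : ~ CRL L.
  apply: complete_dense_not_CRL => //; first exact: ereal_dense.
  move=> S; exists (ereal_sup S).
  by split=> [|y]; [exact: ereal_sup_ubound|exact: ge_ereal_sup].
split; last by exists _, L, nat, U, FU.
by move=> closed; exact/nCRL/(closed _ _ _ _ FU).
Qed.
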